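(* For each (possibly nonunital) ring $R$ let $\approx_R$ be an equivalence relation on $R$ such that the family $\{\approx_R \mid R \text{ a ring}\}$ induces a well defined functor $F \colon \mathbf{Ring} \to \mathbf{Graph}$ in the following way: (i) For each ring $R$ the vertices of $F(R)$ are the equivalence classes $[r]_{\approx_R}$ of elements of $R$ with respect to $\approx_R$, and there is an edge between $[a]_{\approx_R}$ and $[b]_{\approx_R}$ if and only if $ab=ba$. (ii) For each ring morphism $f \colon R \to S$, where $R$ and $S$ are rings, the graph morphism $F(f) \colon F(R) \to F(S)$ is given by $F(f)([r]_{\approx_R}) = [f(r)]_{\approx_S}$ for all $r \in R$. Then for any finite (possibly nonunital) algebra $A$ over a field $\mathbb{F}$ with prime field $GF(p)$, $p$ a prime, and for any $a,b \in A$, the condition $a \approx_A b$ implies $a \sim b$.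
   Context: Rings and algebras are associative and possibly nonunital. $\mathbf{Ring}$ is the category of all (possibly nonunital) rings and ring homomorphisms. $\mathbf{Graph}$ is the category of undirected simple graphs that allow loops, with graph homomorphisms as morphisms. ''Well defined'' means that the edges in (i) do not depend on the choice of representatives of the classes (i.e. if $a\approx_R a'$ and $b\approx_R b'$ then $ab=ba$ iff $a'b'=b'a'$), and that the maps in (ii) do not depend on the choice of representatives. A finite algebra is an algebra with finitely many elements. $GF(p)$ is the field with $p$ elements. For a ring $A$ and $a\in A$, $\langle a\rangle=\{q(a)\mid q\in\mathbb{Z}[x],\ q(0)=0\}$ denotes the subring generated by $a$, and $a\sim b$ means $\langle a\rangle=\langle b\rangle$. *)

(* Defs.v *)
From HB Require Import structures.
From mathcomp Require Import all_boot all_algebra.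
From mathcomp Require Import all_classical.

Set Implicit Arguments.
Unset Strict Implicit.
Unset Printing Implicit Defensive.

Import GRing.Theory.
Local Open Scope classical_set_scope.
Local Open Scope ring_scope.

(* The product of a nonunital ring is a new operation: the ring structures of
   ssralg all have a unit, and the magma operation of monoid.v denotes the
   addition on finite zmodTypes. *)
HB.mixin Record Zmodule_isRng R of GRing.Zmodule R := {
  rng_mul : R -> R -> R;
  rng_mulA : associative rng_mul;
  rng_mulDl : left_distributive rng_mul +%R;
  rng_mulDr : right_distributive rng_mul +%R
}.

#[short(type="rngType")]
HB.structure Definition Rng := {R of Zmodule_isRng R & GRing.Zmodule R}.

Notation "x ∙ y" := (rng_mul x y) (at level 40, left associativity) : ring_scope.

HB.mixin Record isRngMultiplicative (R S : rngType) (f : R -> S) := {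
  rng_morphM : {morph f : x y / x ∙ y}
}.

HB.structure Definition RngMorphism (R S : rngType) :=
  {f of isRngMultiplicative R S f & @Algebra.isNmodMorphism R S f}.

Notation "{ 'rngmorphism' R -> S }" := (RngMorphism.type R S)
  (at level 0, R at level 98, S at level 99,
   format "{ 'rngmorphism'  R  ->  S }") : type_scope.

HB.instance Definition _ (R : rngType) :=
  isRngMultiplicative.Build R R idfun (fun _ _ => erefl).

Lemma rng_comp_morphM (R S T : rngType)
    (g : {rngmorphism S -> T}) (f : {rngmorphism R -> S}) :
  {morph g \o f : x y / x ∙ y}.
Proof. by move=> x y /=; rewrite !rng_morphM. Qed.

HB.instance Definition _ (R S T : rngType)
    (g : {rngmorphism S -> T}) (f : {rngmorphism R -> S}) :=
  isRngMultiplicative.Build R T (g \o f) (rng_comp_morphM g f).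

HB.mixin Record Lmodule_isRngAlgebra (F : comPzRingType) A
    of Rng A & GRing.Lmodule F A := {
  rng_scalerAl : forall (k : F) (x y : A), k *: (x ∙ y) = (k *: x) ∙ y;
  rng_scalerAr : forall (k : F) (x y : A), k *: (x ∙ y) = x ∙ (k *: y)
}.

#[short(type="rngAlgType")]
HB.structure Definition RngAlgebra (F : comPzRingType) :=
  {A of Lmodule_isRngAlgebra F A & Rng A & GRing.Lmodule F A}.

(* [rng_expS a n] is [a] to the power [n + 1]. *)
Definition rng_expS (R : rngType) (a : R) (n : nat) : R := iter n (rng_mul a) a.

(* The value at [a] of a polynomial [q] without constant term; the constant
   coefficient of [q] is ignored. *)
Definition rng_horner (R : rngType) (q : {poly int}) (a : R) : R :=
  \sum_(i < (size q).-1) rng_expS a i *~ q`_i.+1.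

Definition rng_gen (R : rngType) (a : R) : set R :=
  [set rng_horner q a | q in [set q : {poly int} | q.[0] = 0]].

Definition same_gen (R : rngType) (a b : R) : Prop := rng_gen a = rng_gen b.

Record graph := Graph {
  vertex :> Type;
  edge : vertex -> vertex -> Prop;
  edge_sym : forall u v, edge u v -> edge v u
}.

Record graph_hom (G H : graph) := GraphHom {
  graph_hom_fun :> G -> H;
  graph_hom_edge : forall u v, edge u v -> edge (graph_hom_fun u) (graph_hom_fun v)
}.

Definition is_functor (Fobj : rngType -> graph)
    (Fmap : forall R S : rngType,
      {rngmorphism R -> S} -> graph_hom (Fobj R) (Fobj S)) : Prop :=
  (forall R : rngType, Fmap R R idfun =1 id) /\
  (forall (R S T : rngType) (g : {rngmorphism S -> T}) (f : {rngmorphism R -> S}),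
     Fmap R T (g \o f) =1 Fmap S T g \o Fmap R S f).

Definition eqclass (T : Type) (e : T -> T -> Prop) : Type :=
  {C : set T | exists r, C = [set x | e r x]}.

Definition class_of (T : Type) (e : T -> T -> Prop) (r : T) : eqclass e :=
  exist _ [set x | e r x] (ex_intro _ r erefl).

Definition induces_functor (approx : forall R : rngType, R -> R -> Prop) : Prop :=
  exists (E : forall R : rngType, eqclass (approx R) -> eqclass (approx R) -> Prop)
         (Esym : forall (R : rngType) u v, E R u v -> E R v u),
  let Fobj R := Graph (Esym R) in
  exists Fmap : forall R S : rngType,
      {rngmorphism R -> S} -> graph_hom (Fobj R) (Fobj S),
  [/\ is_functor Fmap,
      forall (R : rngType) (a b : R),
        E R (class_of (approx R) a) (class_of (approx R) b) <-> a ∙ b = b ∙ a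
    & forall (R S : rngType) (f : {rngmorphism R -> S}) (r : R),
        Fmap R S f (class_of (approx R) r) = class_of (approx S) (f r)].

(* For equivalence relations, the existence of the induced functor amounts to
   its edges and its maps not depending on the representatives. *)
Lemma induces_functorP (approx : forall R : rngType, R -> R -> Prop) :
  (forall R : rngType, RelationClasses.Equivalence (approx R)) ->
  induces_functor approx <->
  (forall (R : rngType) (a a' b b' : R), approx R a a' -> approx R b b' ->
     a ∙ b = b ∙ a <-> a' ∙ b' = b' ∙ a') /\
  (forall (R S : rngType) (f : {rngmorphism R -> S}) (r r' : R),
     approx R r r' -> approx S (f r) (f r')).
Proof.
move=> approxE.
have clsP (R : rngType) (a b : R) :
    class_of (approx R) a = class_of (approx R) b <-> approx R a b.
  have [rf sy tr] := approxE R; split=> [/(congr1 sval)/= ab|ab].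
    by have: [set x | approx R b x] b by []; rewrite -ab.
  apply: eq_exist; apply/seteqP; split=> x /=; last exact: tr.
  by move=> ax; apply: tr ax; exact: sy.
split=> [[E [Esym [Fmap [_ EP FmapP]]]]|[EP FmapP]].
  split=> [R a a' b b' /clsP aa' /clsP bb'|R S f r r' /clsP rr'].
    by rewrite -!EP aa' bb'.
  by apply/clsP; rewrite -!FmapP rr'.
pose rep (R : rngType) (C : eqclass (approx R)) : R := sval (cid (svalP C)).
have repK (R : rngType) : cancel (@rep R) (@class_of R (approx R)).
  by case=> C CP; apply: eq_exist; rewrite /rep; case: cid.
have rep_cls (R : rngType) (a : R) : approx R (rep R (class_of _ a)) a.
  by apply/clsP; exact: repK.
pose E (R : rngType) (C D : eqclass (approx R)) :=
  rep R C ∙ rep R D = rep R D ∙ rep R C.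
exists E, (fun R u v => @esym _ _ _) => Fobj.
have Fmap_edge (R S : rngType) (f : {rngmorphism R -> S}) (u v : Fobj R) :
    edge u v -> @edge (Fobj S) (class_of _ (f (rep R u)))
                               (class_of _ (f (rep R v))).
  move=> uv; apply/(EP S _ (f (rep R u)) _ (f (rep R v))) => //.
  by rewrite -!rng_morphM; congr (f _).
exists (fun R S f => GraphHom (Fmap_edge R S f)); split=> [||R S f r] /=.
- split=> [R C|R S T g f C] /=; first exact: repK.
  by apply/esym/clsP; apply: (FmapP _ _ g); exact: rep_cls.
- by move=> R a b; exact: EP.
- by apply/clsP; apply: FmapP; exact: rep_cls.
Qed.

(* Main.v *)
(* Let [U] be the Dorroh extension ['F_p * A] and embed [A] into the ring of
   ['F_p]-linear endomorphisms of [U] by left multiplication. As the algebra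
   ['F_p[a]] generated by [a] in [U] is self-injective, there is an
   ['F_p[a]]-linear retraction [pi] of [U] onto it. It commutes with [a], hence
   with [b] if [a] and [b] are related, and then [b = b * pi 1 = pi (b * 1)] lies
   in ['F_p[a]], hence in its intersection with [A], the subring generated
   by [a]. *)
Require Import Defs.
From HB Require Import structures.
From mathcomp Require Import all_boot all_algebra all_field.
From mathcomp Require Import all_classical.

Set Implicit Arguments.
Unset Strict Implicit.
Unset Printing Implicit Defensive.

Import GRing.Theory.
Local Open Scope classical_set_scope.
Local Open Scope ring_scope.

(** * Linear algebra: retractions onto one-generated subalgebras *)

Lemma separating_functional (K : fieldType) (V : vectType K) (U : {vspace V})
    (v : V) : v \notin U ->
  exists2 phi : 'Hom(V, K^o), phi v = 1 & {in U, forall u, phi u = 0}.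
Proof.
move=> Uv; pose w := v - projv U v.
have w0 : free [tuple w].
  by rewrite seq1_free subr_eq0; apply: contraNneq Uv => ->; exact: memv_proj.
(* Subtracting the projection kills [U] and sends [v] to [w], whose own coordinate is 1. *)
exists (linfun (coord [tuple w] ord0 : V -> K^o) \o (\1 - projv U))%VF.
  by rewrite comp_lfunE !lfunE /= !lfunE /= (coord_free ord0 ord0 w0).
by move=> u uU; rewrite comp_lfunE !lfunE /= !lfunE /= projv_id // subrr linear0.
Qed.

Section Retraction.
Variables (K : fieldType) (L : falgType K).
Implicit Types (a : L) (d : nat).

Definition powers a d : {vspace L} := (\sum_(i < d) <[a ^+ i]>)%VS.

Lemma powers_mem a d i : (i < d)%N -> a ^+ i \in powers a d.
Proof.
by move=> lt_id; rewrite memvE (sumv_sup (Ordinal lt_id)) // -memvE memv_line.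
Qed.

(** Otherwise each new power would enlarge the span, whose dimension is bounded by that of [L]. *)
Lemma powers_stable a : exists d, a ^+ d \in powers a d.
Proof.
apply: contrapT => /forallNP stab.
have dimP d : (d <= \dim (powers a d))%N.
  elim: d => // d /leq_ltn_trans; apply.
  rewrite (ltn_leqif (dimv_leqif_sup _)) /powers big_ord_recr ?addvSl //=.
  by apply/negP => /(subv_trans (addvSr _ _)); rewrite -memvE; exact: stab.
by have := leq_trans (dimP (\dim {:L}).+1) (dimvS (subvf _)); rewrite ltnn.
Qed.

(* [K[a]] is a Frobenius algebra, hence self-injective: if [phi] vanishes on
   [a ^+ i] for [i < d - 1] and [phi (a ^+ (d - 1)) = 1], where [d] is the degree
   of the minimal polynomial [m] of [a], then the values at [a] of the
   [drop_poly i.+1 m] form the basis of [K[a]] dual to the [a ^+ i] with respect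
   to the bilinear form [(x, y) |-> phi (x * y)]. *)
Lemma horner_alg_retraction a : exists pi : 'End(L),
  [/\ pi 1 = 1, forall x, pi (a * x) = a * pi x
    & forall x, exists q : {poly K}, pi x = horner_alg a q].
Proof.
(* The least such [d] is the degree of the minimal polynomial. It is positive because [1] is
   nonzero, and is written [n.+1] below. *)
case: (ex_minnP (powers_stable a)) => -[|n].
  by rewrite /powers big_ord0 memv0 expr0 oner_eq0.
move=> /memv_sumP[vs vsP vsE] dmin.
have /separating_functional[phi phi1 phi0] : a ^+ n \notin powers a n.
  by apply/negP => /dmin; rewrite ltnn.
have /choice[c cE] (i : 'I_n.+1) : exists k, vs i = k *: a ^+ i.
  by apply/vlineP; exact: vsP.
pose c' i := if insub i is Some j then c j else 0.
pose m : {poly K} := 'X^(n.+1) - \poly_(i < n.+1) c' i.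
have sz_m : size m = n.+2.
  by rewrite size_polyDl size_polyXn // size_polyN ltnS size_poly.
have m_lead : m`_n.+1 = 1 by rewrite coefB coefXn eqxx coef_poly ltnn subr0.
have ma0 : horner_alg a m = 0.
  rewrite rmorphB rmorphXn /= horner_algX vsE poly_def rmorph_sum /=.
  apply/eqP; rewrite subr_eq0; apply/eqP/eq_bigr => i _.
  by rewrite cE linearZ /= rmorphXn /= horner_algX /c' valK mulr_algl.
pose e i := horner_alg a (drop_poly i m).
have eS i : a * e i.+1 = e i - m`_i *: 1.
  (* Horner recursion: [drop_poly i m] is the indeterminate times [drop_poly i.+1 m] plus the
     coefficient of degree [i]. *)
  apply/eqP; rewrite eq_sym subr_eq; apply/eqP.
  have -> : e i = horner_alg a ('X * drop_poly i.+1 m + (m`_i)%:P).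
    congr (horner_alg a _); apply/polyP => -[|j].
      by rewrite !coefE /= add0r.
    by rewrite !coefE /= addr0 addSnnS.
  by rewrite rmorphD rmorphM /= horner_algX horner_algC.
have e0 : e 0 = 0 by rewrite /e drop_poly0l.
have en : e n.+1 = 1.
  rewrite /e (_ : drop_poly n.+1 m = 1) ?rmorph1 //; apply/polyP => -[|i].
    by rewrite coef_drop_poly coef1 add0n m_lead.
  by rewrite coef_drop_poly coef1 nth_default // sz_m addSnnS leq_addl.
(* On [K[a]] this is the expansion in the dual basis; the formula makes sense on all of [L]. *)
pose pi (v : L) := \sum_(i < n.+1) (phi (a ^+ i * v) : K) *: e i.+1.
have pi_lin : linear pi.
  move=> k u v; rewrite /pi scaler_sumr -big_split; apply: eq_bigr => i _ /=.
  by rewrite mulrDr -scalerAr linearP scalerDl scalerA.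
pose pil : {linear L -> L} := HB.pack pi
  (GRing.isLinear.Build _ _ _ _ pi pi_lin).
have piE v : linfun pil v = pi v by rewrite lfunE.
exists (linfun pil); split=> [|v|v]; rewrite !piE.
- rewrite /pi big_ord_recr /= big1 => [|i _].
    by rewrite mulr1 phi1 scale1r en add0r.
  by rewrite mulr1 phi0 ?scale0r ?powers_mem.
(* By [eS] and a shift of index, where [e 0 = 0], both sides differ by a multiple of
   [phi (m(a) * v)], and [m(a) = 0]. *)
- have -> : a * pi v = pi (a * v) - (phi (horner_alg a m * v) : K) *: 1.
    have hornE : phi (horner_alg a m * v) =
        \sum_(i < n.+2) m`_i * (phi (a ^+ i * v) : K).
      rewrite -[in LHS](coefK m) sz_m poly_def linear_sum mulr_suml linear_sum.
      apply: eq_bigr => i _.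
      by rewrite linearZ rmorphXn /= horner_algX mulr_algl -scalerAl linearZ.
    have recl : \sum_(i < n.+2) (phi (a ^+ i * v) : K) *: e i = pi (a * v).
      rewrite big_ord_recl e0 scaler0 add0r; apply: eq_bigr => i _.
      by rewrite mulrA -exprSr.
    rewrite hornE -recl !(big_ord_recr n.+1) /= en m_lead mul1r scalerDl.
    rewrite opprD addrACA subrr addr0 scaler_suml -sumrB mulr_sumr; apply: eq_bigr => i _.
    by rewrite -scalerAr eS scalerBr scalerA mulrC.
  by rewrite ma0 mul0r linear0 scale0r subr0.
- exists (\sum_(i < n.+1) (phi (a ^+ i * v) : K) *: drop_poly i.+1 m).
  by rewrite linear_sum; apply: eq_bigr => i _; rewrite linearZ /= mulr_algl.
Qed.
End Retraction.

(** * Endomorphism rings and elementary identities *)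

HB.instance Definition _ (K : fieldType) (V : vectType K) :=
  Zmodule_isRng.Build 'End(V) (@comp_lfunA _ _ _ _ _)
    (fun f g h => comp_lfunDl f g h) (fun f g h => comp_lfunDr f g h).

Section RngTheory.
Variable A : rngType.
Implicit Types x y : A.

Lemma rng_mulr0 x : x ∙ 0 = 0.
Proof. by apply: (addrI (x ∙ 0)); rewrite -rng_mulDr !addr0. Qed.

Lemma rng_mul0r x : 0 ∙ x = 0.
Proof. by apply: (addrI (0 ∙ x)); rewrite -rng_mulDl !addr0. Qed.

Lemma rng_mulrnAr x y n : x ∙ (y *+ n) = (x ∙ y) *+ n.
Proof. by elim: n => [|n IHn]; rewrite ?rng_mulr0 // !mulrS rng_mulDr IHn. Qed.

Lemma rng_mulrnAl x y n : (x *+ n) ∙ y = (x ∙ y) *+ n.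
Proof. by elim: n => [|n IHn]; rewrite ?rng_mul0r // !mulrS rng_mulDl IHn. Qed.
End RngTheory.

(** * The Dorroh extension *)

Section Dorroh.
Variables (p : nat) (A : rngType).
Hypotheses (p_pr : prime p) (pA0 : forall x : A, x *+ p = 0).

(* The two hypotheses are phantom parameters of the type: they make the
   multiplication below, where ['F_p] acts by natural multiples, a ring law. *)
Definition dorroh of prime p & (forall x : A, x *+ p = 0) : Type :=
  ('F_p * A)%type.
Local Notation U := (dorroh p_pr pA0).

HB.instance Definition _ := GRing.Zmodule.copy U ('F_p * A)%type.

Definition dorroh_one : U := (1, 0).
Definition dorroh_mul (u v : U) : U :=
  (u.1 * v.1, v.2 *+ u.1 + u.2 *+ v.1 + u.2 ∙ v.2).

Lemma mulrn_modp (x : A) n : x *+ (n %% p) = x *+ n.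
Proof.
by rewrite [in RHS](divn_eq n p) mulrnDr mulnC mulrnA pA0 mul0rn add0r.
Qed.

Lemma mulrn_FpD (x : A) (k l : 'F_p) : x *+ (k + l)%R = x *+ k + x *+ l.
(* Addition in ['F_p] reduces representatives modulo [p], which multiples in [A] do not see. *)
Proof. by rewrite /= -mulrnDr -[RHS]mulrn_modp [X in (_ %% X)%N]Fp_cast. Qed.

Lemma mulrn_FpM (x : A) (k l : 'F_p) : x *+ (k * l)%R = x *+ k *+ l.
Proof. by rewrite /= -mulrnA -[RHS]mulrn_modp [X in (_ %% X)%N]Fp_cast. Qed.

Lemma dorroh_mulA : associative dorroh_mul.
Proof.
move=> u v w; congr (_, _); rewrite /= ?mulrA //.
rewrite !mulrn_FpM !rng_mulDl !rng_mulDr !mulrnDl !rng_mulrnAl !rng_mulrnAr.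
rewrite rng_mulA -!mulrnA ![(u.1 * _)%N]mulnC !addrA.
by rewrite [LHS](ACl (1*2*4*6*3*5*7)).
Qed.

Lemma dorroh_mul1r : left_id dorroh_one dorroh_mul.
Proof.
move=> [k x]; congr (_, _); rewrite /= ?mul1r //.
by rewrite mul0rn rng_mul0r !addr0.
Qed.

Lemma dorroh_mulr1 : right_id dorroh_one dorroh_mul.
Proof.
move=> [k x]; congr (_, _); rewrite /= ?mulr1 //.
by rewrite mul0rn rng_mulr0 addr0 add0r.
Qed.

Lemma dorroh_mulDl : left_distributive dorroh_mul +%R.
Proof.
move=> u v w; congr (_, _); rewrite /= ?mulrDl //.
rewrite mulrn_FpD mulrnDl rng_mulDl.
by rewrite [RHS]addrACA; congr (_ + _); rewrite addrACA.
Qed.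

Lemma dorroh_mulDr : right_distributive dorroh_mul +%R.
Proof.
move=> u v w; congr (_, _); rewrite /= ?mulrDr //.
rewrite mulrn_FpD mulrnDl rng_mulDr.
by rewrite [RHS]addrACA; congr (_ + _); rewrite addrACA.
Qed.

Lemma dorroh_1neq0 : dorroh_one != 0.
Proof. by apply/eqP => /(congr1 fst)/eqP; rewrite /= oner_eq0. Qed.

HB.instance Definition _ := GRing.Zmodule_isNzRing.Build U
  dorroh_mulA dorroh_mul1r dorroh_mulr1 dorroh_mulDl dorroh_mulDr dorroh_1neq0.
End Dorroh.

(** * The left regular representation *)

Definition ring_rng (R : pzRingType) : Type := R.

HB.instance Definition _ (R : pzRingType) := GRing.Zmodule.on (ring_rng R).
HB.instance Definition _ (R : pzRingType) :=
  Zmodule_isRng.Build (ring_rng R) (@mulrA R) (@mulrDl R) (@mulrDr R).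

Section LeftRegular.
Variables (K : fieldType) (L : falgType K).

Definition left_regular (u : ring_rng L) : 'End(L) := amull u.

Lemma left_regularD : nmod_morphism left_regular.
Proof. by split=> [|u v]; rewrite /left_regular (raddf0, raddfD). Qed.

Lemma left_regularM : {morph left_regular : u v / u ∙ v}.
Proof. by move=> u v; apply/lfunP=> w; rewrite comp_lfunE !lfunE /= mulrA. Qed.

HB.instance Definition _ :=
  Algebra.isNmodMorphism.Build (ring_rng L) 'End(L) left_regular left_regularD.
HB.instance Definition _ :=
  isRngMultiplicative.Build (ring_rng L) 'End(L) left_regular left_regularM.
End LeftRegular.

(** * Generated subrings of [A] seen in the Dorroh extension *)

Section DorrohInj.
Variables (p : nat) (A : rngType).
Hypotheses (p_pr : prime p) (pA0 : forall x : A, x *+ p = 0).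
Local Notation U := (dorroh p_pr pA0).

Definition dorroh_inj (x : A) : ring_rng U := (0, x).

Lemma dorroh_injD : nmod_morphism dorroh_inj.
Proof. by split=> [|x y] //; congr (_, _); rewrite /= addr0. Qed.

Lemma dorroh_injM : {morph dorroh_inj : x y / x ∙ y}.
Proof. by move=> x y; congr (_, _); rewrite /= ?mulr0 // mulr0n !add0r. Qed.

HB.instance Definition _ :=
  Algebra.isNmodMorphism.Build A (ring_rng U) dorroh_inj dorroh_injD.
HB.instance Definition _ :=
  isRngMultiplicative.Build A (ring_rng U) dorroh_inj dorroh_injM.

Lemma dorroh_natr n : n%:R = (n%:R, 0) :> U.
Proof. by rewrite -[LHS]/((1, 0) *+ n : 'F_p * A) pairMnE /= mul0rn. Qed.

Lemma dorroh_pchar : p \in [pchar U].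
Proof. by apply/andP; split; rewrite // dorroh_natr pchar_Fp_0. Qed.

Local Notation L := (pPrimeCharType dorroh_pchar).

Lemma dorroh_inj_expS (a : A) i :
  dorroh_inj (rng_expS a i) = dorroh_inj a ^+ i.+1 :> U.
Proof.
elim: i => [|i IHi]; first by rewrite expr1.
by rewrite /rng_expS iterS rng_morphM exprS -IHi.
Qed.

Lemma dorroh_inj_horner (a : A) (q : {poly int}) : q.[0] = 0 ->
  dorroh_inj (rng_horner q a) =
  horner_alg (dorroh_inj a : L) (map_poly intr q) :> L.
Proof.
move=> q0; rewrite /rng_horner raddf_sum.
case sz_q: (size q) => [|n].
  by move/eqP: sz_q; rewrite size_poly_eq0 => /eqP->; rewrite big_ord0 !rmorph0.
rewrite -[q in RHS]coefK poly_def sz_q big_ord_recl -horner_coef0 q0.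
rewrite scale0r add0r !rmorph_sum; apply: eq_bigr => i _ /=.
rewrite raddfMz /= dorroh_inj_expS map_polyZ map_polyXn /=.
by rewrite -mul_polyC rmorphM rmorphXn /= horner_algC horner_algX mulr_algl scaler_int.
Qed.

(** The first projection is a morphism of algebras onto ['F_p] that kills the image of [A]. *)
Lemma dorroh_horner1 (a : A) (q : {poly 'F_p}) :
  (horner_alg (dorroh_inj a : L) q : U).1 = q.[0].
Proof.
elim/poly_ind: q => [|q c IHq]; first by rewrite rmorph0 horner0.
rewrite hornerMXaddC mulr0 add0r rmorphD rmorphM /= horner_algX horner_algC /=.
by rewrite mulr0 add0r mulr1 dorroh_natr natr_Zp.
Qed.

(** A polynomial value that lies in [A] has first component 0, so by [dorroh_horner1] the constant
    term vanishes. *)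
Lemma mem_rng_gen (a b : A) : rng_gen a b <->
  exists q : {poly 'F_p}, dorroh_inj b = horner_alg (dorroh_inj a : L) q :> L.
Proof.
split=> [[q /= q0 <-]|[q bE]].
  by exists (map_poly intr q); rewrite dorroh_inj_horner.
(* Lift coefficients to their representatives below [p]; zero lifts to zero, so the constant term
   stays zero. *)
pose q' : {poly int} := map_poly (fun k : 'F_p => (k : nat)%:Z) q.
have q'K : map_poly intr q' = q.
  apply/polyP => i; rewrite coef_map coef_map_id0 //; exact: natr_Zp.
have q'0 : q'.[0] = 0.
  rewrite horner_coef0 coef_map_id0 // -horner_coef0.
  by rewrite -(dorroh_horner1 a) -bE.
exists q' => //.
by move: bE; rewrite -q'K -dorroh_inj_horner // => -[].
Qed.

Lemma rng_gen_sub (a b : A) : rng_gen a b -> rng_gen b `<=` rng_gen a.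
Proof.
move=> /mem_rng_gen[q bE] c /mem_rng_gen[r cE]; apply/mem_rng_gen.
(* If [b = q(a)] and [c = r(b)], then [c] is the value at [a] of the composite. *)
exists (r \Po q); rewrite cE bE; elim/poly_ind: r {cE} => [|r k IHr].
  by rewrite comp_poly0 !rmorph0.
rewrite comp_polyD comp_polyM comp_polyX comp_polyC !rmorphD !rmorphM /=.
by rewrite IHr !horner_algC horner_algX.
Qed.
End DorrohInj.

(** * Consequences of functoriality *)

Section Functor.
Variable approx : forall R : rngType, R -> R -> Prop.
Hypothesis approx_equiv :
  forall R : rngType, RelationClasses.Equivalence (@approx R).
Hypothesis approx_functor : induces_functor approx.

Lemma approx_comm (R : rngType) (a b c : R) :
  approx a b -> c ∙ a = a ∙ c -> c ∙ b = b ∙ c.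
Proof.
move=> ab; have [commP _] := (induces_functorP approx_equiv).1 approx_functor.
by apply: (commP R _ _ _ _ _ ab).1; have [rf _ _] := approx_equiv R.
Qed.

Lemma approx_morph (R S : rngType) (f : {rngmorphism R -> S}) (a b : R) :
  approx a b -> approx (f a) (f b).
Proof. exact: ((induces_functorP approx_equiv).1 approx_functor).2. Qed.

Lemma approx_horner (K : fieldType) (L : falgType K) (a b : ring_rng L) :
  approx a b -> exists q : {poly K}, b = horner_alg (a : L) q.
Proof.
move=> ab; have [pi [pi1 piM piP]] := horner_alg_retraction (a : L).
(* Functoriality moves the relation into the endomorphism ring, where [pi] is an element that can be
   tested for commutation. *)
have /(approx_comm (approx_morph (left_regular (L := L)) ab)) :
    (pi : 'End(L)) ∙ left_regular a = left_regular a ∙ pi.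
  by apply/lfunP => x; rewrite !comp_lfunE !lfunE /= piM.
move=> /lfunP/(_ 1); rewrite !comp_lfunE !lfunE /= pi1 !mulr1 => <-.
exact: piP.
Qed.

Lemma approx_rng_gen (p : nat) (A : rngType) (a b : A) :
  prime p -> (forall x : A, x *+ p = 0) -> finite_set [set: A] ->
  approx a b -> rng_gen a b.
Proof.
move=> p_pr pA0 finA ab.
pose U := dorroh p_pr pA0.
have [s sE] : exists s : seq U, forall u, u \in s.
  have /finite_seqP[s sE] : finite_set [set: U].
    have := finite_setX (finite_finset (X := [set: 'F_p])) finA.
    by rewrite setXTT.
  by exists s => u; have : [set: U] u by []; rewrite sE.
(* Positions in the enumeration [s] provide the countable and finite structures on [U]. Being finite
   of characteristic [p], it is a finite-dimensional algebra over ['F_p], as the retraction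
   requires. *)
have indexK : pcancel (index^~ s) (onth s).
  by move=> u; rewrite onthE (nth_map u) ?nth_index ?index_mem.
have enum_s : Finite.axiom (undup s).
  by apply: Finite.uniq_enumP (undup_uniq s) _ => u; rewrite mem_undup sE.
pose finU : finNzRingType :=
  HB.pack U (PCanIsCountable indexK) (isFinite.Build U enum_s).
pose R := pPrimeCharType (dorroh_pchar p_pr pA0 : p \in [pchar finU]).
pose L : falgType 'F_p := HB.pack R (Algebra_isFalgebra.Build 'F_p R).
have [q qE] := approx_horner
  (approx_morph (dorroh_inj p_pr pA0 : {rngmorphism A -> ring_rng L}) ab).
by apply/(mem_rng_gen p_pr pA0); exists q.
Qed.
End Functor.

Theorem mainTheorem5
  (approx : forall R : rngType, R -> R -> Prop)
  (approx_equiv : forall R : rngType, RelationClasses.Equivalence (approx R))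
  (approx_functor : induces_functor approx)
  (F : fieldType) (p : nat) (pF : p \in [pchar F])
  (A : rngAlgType F) (finA : finite_set [set: A]) (a b : A) :
  approx A a b -> same_gen a b.
Proof.
have p_pr := pcharf_prime pF.
(* Scalars reduce this to [p = 0] in [F]. *)
have pA0 (x : A) : x *+ p = 0 by rewrite -scaler_nat (pcharf0 pF) scale0r.
have gen := approx_rng_gen approx_equiv approx_functor p_pr pA0 finA.
move=> ab; have ba : approx A b a by have [_ sy _] := approx_equiv A; exact: sy.
by apply/seteqP; split; apply: (rng_gen_sub p_pr pA0); exact: gen.
Qed.
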